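(* Let $(X,\|\cdot\|_X)$ and $(Y,\|\cdot\|_Y)$ be finite dimensional strictly convex real normed spaces and let $\tau:S_X\to S_Y$ be an onto isometry between their unit spheres. If there is a nonempty relatively open subset $U\subset S_X$ on which $\tau$ is linear, then $\tau$ is linear on $S_X$.
   Context: $S_X$ and $S_Y$ denote the unit spheres, with the distances $\|x-x'\|_X$ and $\|y-y'\|_Y$ respectively; an onto isometry is a surjective distance-preserving map. A normed space is strictly convex if its unit sphere contains no nondegenerate segment. For a subset $A\subset S_X$, ''$\tau$ is linear on $A$'' means that there is a linear map $T:X\to Y$ with $\tau(x)=T(x)$ for every $x\in A$. *)

(* Defs.v *)
From HB Require Import structures.
From mathcomp Require Import all_boot all_order all_algebra.
From mathcomp Require Import all_classical all_reals all_analysis.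

Set Implicit Arguments.
Unset Strict Implicit.
Unset Printing Implicit Defensive.

Import Order.TTheory GRing.Theory Num.Theory.
Import numFieldNormedType.Exports.

Local Open Scope classical_set_scope.
Local Open Scope ring_scope.

#[short(type="normedVectType")]
HB.structure Definition NormedVector (R : realType) :=
  {V of NormedModule R V & Vector R V}.

Definition unit_sphere (R : realType) (V : normedModType R) : set V :=
  [set x | `|x| = 1].
Arguments unit_sphere {R} V.

Definition segment (R : realType) (V : normedModType R) (x y : V) : set V :=
  [set (1 - t) *: x + t *: y | t in `[0, 1]].

Definition strictly_convex (R : realType) (V : normedModType R) : Prop :=
  forall x y : V, segment x y `<=` unit_sphere V -> x = y.
Arguments strictly_convex {R} V.

(* In [subspace A] the points outside [A] are isolated, hence the separate
   inclusion. *)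
Definition relatively_open (T : topologicalType) (A U : set T) : Prop :=
  U `<=` A /\ open (U : set (subspace A)).

(* Maps between subsets are encoded as total functions of which only the
   restriction to [A] is constrained. *)
Definition onto_isometry (R : realType) (V W : normedModType R)
    (A : set V) (B : set W) (f : V -> W) : Prop :=
  [/\ set_fun A B f,
      set_surj A B f &
      forall x x' : V, A x -> A x' -> `|f x - f x'| = `|x - x'|].

Definition linear_on (R : realType) (V W : normedModType R)
    (A : set V) (f : V -> W) : Prop :=
  exists T : {linear V -> W}, forall x, A x -> f x = T x.

(* Main.v *)
(* Extend [tau] positively homogeneously to [sigma] and let [K] be the interior
   of the set where [sigma] agrees with [T]; on [K] the map [T] preserves norms.
   Let [v] be a unit vector in [K] and follow the segment from [v] to another
   point [x] of the sphere. At the first point leaving [K], normalized to [x],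
   the direction of [x + v] is still in [K]. For a unit vector [y] near [x] put
   [z = tau y], [a = T y], [b = T v]; then for every unit [u] near [v]
     |a + T u| = |y + u| = |tau y - tau (- u)| = |z + tau u| = |z + T u|.
   Taking [u = v] gives |a + b| = |z + b|. By the intermediate value theorem
   and surjectivity of [tau] some [u] near [v] satisfies
   [a + T u = c (z + b)] with [c > 0], which gives |z + b| = |z + b + (z - a)/c|.
   Thus three points of a line have the same norm, which strict convexity
   forbids unless [z = a]. Hence [K] contains [x] as well. *)
Require Import Defs.
From HB Require Import structures.
From mathcomp Require Import all_boot all_order all_algebra.
From mathcomp Require Import all_classical all_reals all_analysis.
From mathcomp Require Import ring lra.

Set Implicit Arguments.
Unset Strict Implicit.
Unset Printing Implicit Defensive.

Import Order.TTheory GRing.Theory Num.Theory.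
Import numFieldNormedType.Exports.

Local Open Scope classical_set_scope.
Local Open Scope ring_scope.

(** * Norms along a line in a strictly convex space *)

Lemma norm_chord_le (R : realType) (V : normedModType R) (p d : V) (s : R) :
  0 <= s <= 1 -> `|p| = `|p + d| -> `|p + s *: d| <= `|p|.
Proof.
move=> /andP[s0 s1] pd.
have -> : p + s *: d = (1 - s) *: p + s *: (p + d).
  by rewrite scalerBl scale1r scalerDr addrA subrK.
rewrite (le_trans (ler_normD _ _))// !normrZ -pd ger0_norm ?subr_ge0//.
by rewrite (ger0_norm s0) -mulrDl subrK mul1r.
Qed.

(** A point beyond the chord with norm at most [|p|] would, by convexity, keep the norm from
    dropping inside the chord; rescaled, the chord would then lie in the unit sphere. *)
Lemma norm_chord_gt (R : realType) (V : normedModType R) (p d : V) (c : R) :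
  strictly_convex V -> `|p| = `|p + d| -> d != 0 -> 1 < c ->
  `|p| < `|p + c *: d|.
Proof.
move=> hV pd d0 c1; rewrite ltNge; apply/negP => pc.
have r0 : `|p| != 0.
  apply: contraNneq d0 => p0; move: pd; rewrite p0 => /esym/normr0_eq0.
  by move/normr0_eq0 : p0 => ->; rewrite add0r => ->.
suff : `|p|^-1 *: p = `|p|^-1 *: (p + d).
  move/(scalerI (invr_neq0 r0))/esym/eqP; rewrite -subr_eq0 addrAC subrr add0r.
  by rewrite (negbTE d0).
apply: hV => _ [s /= /[!in_itv]/= /andP[s0 s1] <-].
have -> : (1 - s) *: (`|p|^-1 *: p) + s *: (`|p|^-1 *: (p + d)) =
          `|p|^-1 *: (p + s *: d).
  rewrite !scalerA ![_ * `|p|^-1]mulrC -!scalerA -scalerDr; congr (_ *: _).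
  by rewrite scalerBl scale1r scalerDr addrA subrK.
suff ps : `|p + s *: d| = `|p|.
  by rewrite /unit_sphere/= normrZ normfV normr_id ps mulVf.
apply/eqP; rewrite eq_le norm_chord_le ?s0//=.
(* Up to the factor [c - s], this writes [p + d] as a convex combination of its neighbours at
   parameters [s] and [c]. *)
have : (c - s) *: (p + d) = (c - 1) *: (p + s *: d) + (1 - s) *: (p + c *: d).
  rewrite !scalerDr !scalerA addrACA -!scalerDl.
  by congr (_ *: _ + _ *: _); ring.
move/(congr1 Num.norm) => E.
have := ler_normD ((c - 1) *: (p + s *: d)) ((1 - s) *: (p + c *: d)).
have [cs c1' s1'] : [/\ 0 <= c - s, 0 <= c - 1 & 0 <= 1 - s] by split; lra.
rewrite -E !normrZ -pd (ger0_norm cs) (ger0_norm c1') (ger0_norm s1').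
have : (1 - s) * `|p + c *: d| <= (1 - s) * `|p| by rewrite ler_wpM2l// subr_ge0.
move=> h1 h2; have {h1 h2} : (c - 1) * `|p| <= (c - 1) * `|p + s *: d| by lra.
by rewrite ler_pM2l// subr_gt0.
Qed.

(** Equality at [c] would give a shorter chord from [p] to [p + c *: d], beyond which [p + d] lies
    at parameter [c^-1 > 1]. *)
Lemma norm_chord_lt (R : realType) (V : normedModType R) (p d : V) (c : R) :
  strictly_convex V -> `|p| = `|p + d| -> d != 0 -> 0 < c < 1 ->
  `|p + c *: d| < `|p|.
Proof.
move=> hV pd d0 /andP[c0 c1].
rewrite lt_neqAle norm_chord_le ?(ltW c0) ?(ltW c1)// andbT.
apply/eqP => /esym pc.
have cd0 : c *: d != 0 by rewrite scaler_eq0 negb_or gt_eqF.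
have := norm_chord_gt hV pc cd0 (c := c^-1).
by rewrite invf_gt1// scalerA mulVf ?gt_eqF// scale1r -pd ltxx => /(_ c1).
Qed.

(** Otherwise the midpoint of [a] and [- b] would have norm less than 1. *)
Lemma norm_sub_eq2 (R : realType) (V : normedModType R) (a b : V) :
  strictly_convex V -> `|a| = 1 -> `|b| = 1 -> `|a - b| = 2 -> b = - a.
Proof.
move=> hV a1 b1 ab2; apply/eqP; rewrite -subr_eq0 opprK -oppr_eq0 opprD.
apply/negPn/negP => d0.
have := norm_chord_lt (c := 2^-1) (p := a) hV _ d0.
rewrite [a + (_ - _)]addrC subrK normrN a1 b1 => /(_ erefl).
have -> : a + 2^-1 *: (- b - a) = 2^-1 *: (a - b).
  have {1}-> : a = 2^-1 *: (a + a).
    by rewrite -mulr2n -[a *+ 2]scaler_nat scalerA mulVf ?scale1r// pnatr_eq0.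
  by rewrite -scalerDr; congr (_ *: _); rewrite [- b - a]addrC addrA addrK.
rewrite normrZ ab2 normfV ger0_norm ?ler0n// mulVf ?pnatr_eq0// ltxx.
by move=> H; suff: false by []; apply: H; apply/andP; split; lra.
Qed.

(** * The positively homogeneous extension and its local linearity *)

Definition radial_extension (R : realType) (V W : normedModType R)
  (f : V -> W) (q : V) : W := `|q| *: f (`|q|^-1 *: q).

Lemma radial_extension_sphere (R : realType) (V W : normedModType R)
  (f : V -> W) (x : V) : `|x| = 1 -> radial_extension f x = f x.
Proof. by rewrite /radial_extension => ->; rewrite invr1 !scale1r. Qed.

Lemma radial_extensionZ (R : realType) (V W : normedModType R)
  (f : V -> W) (c : R) (q : V) :
  0 < c -> radial_extension f (c *: q) = c *: radial_extension f q.
Proof.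
move=> c0; rewrite /radial_extension normrZ gtr0_norm// scalerA.
by rewrite scalerA invfM mulrAC mulVf ?mul1r// gt_eqF.
Qed.

Lemma normalize_norm (R : realType) (V : normedModType R) (q : V) :
  q != 0 -> `| `|q|^-1 *: q| = 1.
Proof. by move=> q0; rewrite normrZV// unitfE normr_eq0. Qed.

Lemma norm_radial_extension (R : realType) (V W : normedModType R)
  (f : V -> W) (q : V) : (forall x, `|x| = 1 -> `|f x| = 1) ->
  `|radial_extension f q| = `|q|.
Proof.
move=> hf; rewrite /radial_extension normrZ normr_id.
have [->|q0] := eqVneq q 0; first by rewrite normr0 mul0r.
by rewrite hf ?mulr1// normalize_norm.
Qed.

Lemma radial_extension_lipschitz (R : realType) (V W : normedModType R)
    (f : V -> W) (p q : V) :
  (forall x, `|x| = 1 -> `|f x| = 1) ->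
  (forall x y, `|x| = 1 -> `|y| = 1 -> `|f x - f y| = `|x - y|) ->
  `|radial_extension f p - radial_extension f q| <= 3 * `|p - q|.
Proof.
move=> hf hi.
have [->|p0] := eqVneq p 0.
  rewrite {1}/radial_extension normr0 scale0r !sub0r !normrN.
  by rewrite norm_radial_extension// ler_peMl// ler1n.
have [->|q0] := eqVneq q 0.
  rewrite {2}/radial_extension normr0 scale0r !subr0.
  by rewrite norm_radial_extension// ler_peMl// ler1n.
set u := `|p|^-1 *: p; set w := `|q|^-1 *: q.
have u1 : `|u| = 1 by exact: normalize_norm.
have w1 : `|w| = 1 by exact: normalize_norm.
have pE : p = `|p| *: u by rewrite scalerA divff ?scale1r// normr_eq0.
have qE : q = `|q| *: w by rewrite scalerA divff ?scale1r// normr_eq0.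
have pq := ler_dist_dist p q.
have E (Z : normedModType R) (y z : Z) : `|p| *: y - `|q| *: z =
    `|p| *: (y - z) + (`|p| - `|q|) *: z.
  by rewrite scalerBr scalerBl addrA subrK.
(* The difference splits into an angular part, at most twice [|p - q|], and a radial part, at most
   once: hence the constant 3. *)
have uw : `|p| * `|u - w| <= 2 * `|p - q|.
  have : `|p| *: (u - w) = (p - q) - (`|p| - `|q|) *: w.
    by rewrite {2}pE {1}qE E addrK.
  move/(congr1 Num.norm); rewrite normrZ normr_id => ->.
  by rewrite (le_trans (ler_normB _ _))// normrZ w1; lra.
rewrite /radial_extension -/u -/w E (le_trans (ler_normD _ _))// !normrZ.
by rewrite normr_id hi// hf//; lra.
Qed.

Lemma radial_extension_continuous (R : realType) (V W : normedModType R)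
    (f : V -> W) :
  (forall x, `|x| = 1 -> `|f x| = 1) ->
  (forall x y, `|x| = 1 -> `|y| = 1 -> `|f x - f y| = `|x - y|) ->
  continuous (radial_extension f).
Proof.
move=> hf hi p; apply/cvgrPdist_lt => e e0.
have e3 : 0 < e / 3 by rewrite divr_gt0.
near=> q; rewrite (le_lt_trans (radial_extension_lipschitz _ _ hf hi))//.
rewrite mulrC -ltr_pdivlMr//.
Unshelve. all: by end_near. Qed.

Lemma normalize_continuous (R : realType) (V : normedModType R) (p : V) :
  p != 0 -> (`|q|^-1 *: q) @[q --> p] --> `|p|^-1 *: p.
Proof.
move=> p0; apply: cvgZ => //; apply: cvgV; first by rewrite normr_eq0.
exact: cvg_norm.
Qed.

Lemma linear_near_normE (R : realType) (V W : normedModType R)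
    (f : V -> W) (T : {linear V -> W}) (p : V) :
  (forall x, `|x| = 1 -> `|f x| = 1) ->
  (\forall q \near p, radial_extension f q = T q) ->
  \forall q \near p, `|T q| = `|q|.
Proof. by move=> hf; apply: filterS => q <-; exact: norm_radial_extension. Qed.

Lemma radial_extension_linear_nearZ (R : realType) (V W : normedModType R)
    (f : V -> W) (T : {linear V -> W}) (c : R) (p : V) :
  0 < c ->
  (\forall q \near p, radial_extension f q = T q) ->
  \forall q \near c *: p, radial_extension f q = T q.
Proof.
move=> c0 hp.
have : c^-1 *: q @[q --> c *: p] --> p.
  rewrite -[X in _ --> X]scale1r -(mulVf (lt0r_neq0 c0)) -scalerA.
  exact: cvgZr.
move=> /(_ _ hp) hc; near=> q.
have -> : q = c *: (c^-1 *: q) by rewrite scalerA divff ?scale1r// lt0r_neq0.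
rewrite radial_extensionZ// (linearZ_LR T); congr (_ *: _).
by near: q; exact: hc.
Unshelve. all: by end_near. Qed.

(** [T] preserves norms near [p], and [T q = T (q + p) - T p] carries this bound to a neighbourhood
    of 0. *)
Lemma linear_near_continuous (R : realType) (V W : normedModType R)
    (f : V -> W) (T : {linear V -> W}) (p : V) :
  (forall x, `|x| = 1 -> `|f x| = 1) ->
  (\forall q \near p, radial_extension f q = T q) -> continuous T.
Proof.
move=> hf /(linear_near_normE hf) hp; apply/linear_bounded_continuous.
have h : \forall q \near 0, `|T (q + p)| = `|q + p|.
  by apply/(nbhsDl (fun q => `|T q| = `|q|)); rewrite add0r.
apply/ex_bound; exists (1 + `|p| + `|T p|).
near=> q; rewrite /mkset.
have -> : T q = T (q + p) - T p by rewrite linearD addrK.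
rewrite (le_trans (ler_normB _ _))// lerD2r.
rewrite (near h)// (le_trans (ler_normD _ _))// lerD2r ltW//.
Unshelve. all: by end_near. Qed.

(** The images of [u] and [- u] are unit vectors at distance 2, hence antipodal. *)
Lemma sphere_isometryN (R : realType) (V W : normedModType R) (f : V -> W)
    (u : V) :
  strictly_convex W -> (forall x, `|x| = 1 -> `|f x| = 1) ->
  (forall x y, `|x| = 1 -> `|y| = 1 -> `|f x - f y| = `|x - y|) ->
  `|u| = 1 -> f (- u) = - f u.
Proof.
move=> hW hf hi u1; apply: norm_sub_eq2 => //; rewrite ?hf ?normrN// hi ?normrN//.
by rewrite opprK -mulr2n normrMn u1.
Qed.

(** * Propagation of linearity over the sphere *)

Lemma linear_near_of_midpoint (R : realType) (V W : normedModType R) (f : V -> W)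
    (T : {linear V -> W}) (x v : V) :
  strictly_convex W -> onto_isometry (unit_sphere V) (unit_sphere W) f ->
  `|x| = 1 -> `|v| = 1 -> x + v != 0 ->
  (\forall q \near v, radial_extension f q = T q) ->
  (\forall q \near x + v, radial_extension f q = T q) ->
  f x = T x ->
  \forall q \near x, radial_extension f q = T q.
Proof.
move=> hW [hf' hsurj hi'] x1 v1 xv0 Kv Kxv fxT.
have hf w : `|w| = 1 -> `|f w| = 1 by exact: hf'.
have hi w w' : `|w| = 1 -> `|w'| = 1 -> `|f w - f w'| = `|w - w'| by exact: hi'.
have fN := sphere_isometryN hW hf hi.
have Tc := linear_near_continuous hf Kv.
have sc := radial_extension_continuous hf hi.
set b := f v; set m := f x + b.
have b1 : `|b| = 1 by exact: hf.
have m0 : m != 0.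
  by rewrite -normr_eq0 /m -[b]opprK -fN// hi ?normrN// opprK normr_eq0.
have m2 : `|m| <= 2 by rewrite (le_trans (ler_normD _ _))// b1 hf//; lra.
(* The chord from [- f x] in direction [m] ends at the unit vector [b]. Along it the norm is below 1
   just before [b] and above 1 just after, which brackets the value 1 for the intermediate value
   theorem. *)
have xm : `|- f x| = `|- f x + m|.
  by rewrite normrN (hf _ x1) /m addrA addNr add0r b1.
have [e1 /= e10 he1] := (@nbhs_normP _ _ _ _).1 Kv.
have [e2 /= e20 he2] := (@nbhs_normP _ _ _ _).1 (linear_near_normE hf Kxv).
(* [e1] will put [u] where the extension is [T]; [e2 / 2] leaves room for moving both [x] and [v]
   inside the ball around [x + v]; 4 ensures [k <= 1/2]. With [k = e / 8], the three error terms in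
   [bb] add up to less than [5 * k < e]. *)
pose e := Num.min (Num.min e1 (e2 / 2)) 4.
have e0 : 0 < e by rewrite !lt_min e10 divr_gt0//=.
have [ee1 ee2 e4] : [/\ e <= e1, e <= e2 / 2 & e <= 4].
  by rewrite /e !ge_min !lexx !orbT.
pose k := e / 8.
have [k0 k12] : 0 < k /\ k <= 2^-1 by rewrite /k; lra.
have lo : `|(1 - k) *: m - f x| < 1.
  rewrite addrC -[ltRHS](hf _ x1) -[ltRHS]normrN; apply: norm_chord_lt => //.
  by apply/andP; split; lra.
have up : 1 < `|(1 + k) *: m - f x|.
  rewrite addrC -[ltLHS](hf _ x1) -[ltLHS]normrN; apply: norm_chord_gt => //; lra.
have gc (c : R) : c *: (radial_extension f y + b) - T y @[y --> x] -->
    c *: m - f x.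
  rewrite fxT; apply: cvgB; last exact: Tc.
  apply: cvgZr; apply: cvgD; last exact: cvg_cst.
  by rewrite -(radial_extension_sphere f x1); exact: sc.
(* By homogeneity it is enough to treat unit vectors. *)
suff H : \forall y \near x, `|y| = 1 -> f y = T y.
  have x0 : x != 0 by rewrite -normr_eq0 x1 oner_neq0.
  have := normalize_continuous x0; rewrite x1 invr1 scale1r => /(_ _ H) H'.
  near=> q.
  have q0 : q != 0.
    by near: q; exact: (@cvgr_neq0 _ _ _ _ _ id x).
  have /(_ (normalize_norm q0)) fq : `| `|q|^-1 *: q| = 1 ->
      f (`|q|^-1 *: q) = T (`|q|^-1 *: q) by near: q; exact: H'.
  by rewrite /radial_extension fq (linearZ_LR T) scalerA divff ?scale1r// normr_eq0.
near=> y => y1.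
have yx : `|x - y| < e2 / 2.
  by near: y; apply: (@cvgr_dist_lt _ _ _ _ _ id); rewrite ?divr_gt0.
set z := f y; set a := T y.
have zE : radial_extension f y = z by exact: radial_extension_sphere.
have zx : `|z - f x| < k.
  rewrite -zE distrC -(radial_extension_sphere f x1).
  by near: y; move/cvgrPdist_lt : (sc x); exact.
have ax : `|f x - a| < k.
  by rewrite /a fxT; near: y; move/cvgrPdist_lt : (Tc x); exact.
have glo : `|(1 - k) *: (z + b) - a| < 1.
  by rewrite -zE /a; near: y; exact: (cvgr_norm_lt _ (gc _) _ lo).
have ghi : 1 < `|(1 + k) *: (z + b) - a|.
  by rewrite -zE /a; near: y; exact: (cvgr_norm_gt _ (gc _) _ up).
have [c /[!in_itv]/= /andP[c1 c2] gc1] : exists2 c, c \in `[1 - k, 1 + k] &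
    `|c *: (z + b) - a| = 1.
  apply: IVT; first lra.
    apply: continuous_subspaceT => c; apply: cvg_norm; apply: cvgB.
      by apply: cvgZl; exact: cvg_id.
    exact: cvg_cst.
  by rewrite ge_min le_max (ltW glo) (ltW ghi) orbT.
set b' := c *: (z + b) - a.
have bb : `|b' - b| < e.
  have -> : b' - b = c *: (z - f x) + (c - 1) *: m + (f x - a).
    rewrite /b' scalerBl scale1r [_ + (_ *: m - m)]addrA -scalerDr /m [z - f x + _]addrA subrK.
    rewrite -[RHS]addrA -[LHS]addrA; congr (_ + _).
    by rewrite opprD [- f x - b]addrC addrA subrK addrC.
  have h1 : `|c *: (z - f x)| <= 2 * k.
    by rewrite normrZ ler_pM// ?ltW// ger0_norm; lra.
  have h2 : `|(c - 1) *: m| <= k * 2.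
    by rewrite normrZ ler_pM//; rewrite ler_norml; apply/andP; split; lra.
  rewrite (le_lt_trans (ler_normD _ _))//.
  by have := ler_normD (c *: (z - f x)) ((c - 1) *: m); rewrite /k in h1 h2 ax *; lra.
have [u u1 fu] := hsurj b' gc1.
have uv : `|v - u| < e by rewrite distrC -hi// fu.
have b'T : b' = T u.
  rewrite -fu -(radial_extension_sphere f u1); apply: he1 => /=.
  exact: lt_le_trans ee1.
(* On the left, [T] preserves the norm of [y + w], which is near [x + v]; on the right,
   [f w = - f (- w)] turns the sum into a distance. *)
have eqn w : `|w| = 1 -> `|v - w| < e -> f w = T w -> `|a + f w| = `|z + f w|.
  move=> w1 vw fw.
  rewrite -[f w in RHS]opprK -fN// hi ?normrN// opprK fw -linearD he2//=.
  rewrite opprD addrACA (le_lt_trans (ler_normD _ _))//; lra.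
have E1 : `|a + b| = `|z + b|.
  apply: eqn; rewrite ?subrr ?normr0//.
  by rewrite -(radial_extension_sphere f v1); exact: nbhs_singleton Kv.
have E2 : `|a + b'| = `|z + b'| by rewrite -fu; apply: eqn; rewrite ?fu.
apply/eqP; rewrite -subr_eq0; apply/negPn/negP => d0.
have cgt0 : 0 < c by lra.
have zb : a + b + (z - a) = z + b by rewrite addrC addrA subrK.
have zb' : a + b + (1 + c^-1) *: (z - a) = c^-1 *: (z + b').
  rewrite scalerDl scale1r [LHS]addrA zb /b' [z + (_ - a)]addrCA [RHS]scalerDr.
  by rewrite scalerA mulVf ?gt_eqF// scale1r.
(* At parameter [1 + c^-1] the line passes through [c^-1 *: (z + b')], whose norm is that of
   [c^-1 *: (a + b') = z + b]. *)
have := norm_chord_gt (p := a + b) (d := z - a) (c := 1 + c^-1) hW.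
rewrite zb zb'; move=> /(_ E1 d0).
rewrite E1 normrZ -E2 /b' [a + _]addrC subrK normrZ normfV !gtr0_norm//.
by rewrite mulKf ?gt_eqF// ltxx ltrDl invr_gt0 => /(_ cgt0).
Unshelve. all: by end_near. Qed.

Lemma linear_near_sphere (R : realType) (V W : normedModType R) (f : V -> W)
    (T : {linear V -> W}) (v x : V) :
  strictly_convex W -> onto_isometry (unit_sphere V) (unit_sphere W) f ->
  `|v| = 1 -> `|x| = 1 -> x != - v ->
  (\forall q \near v, radial_extension f q = T q) ->
  \forall q \near x, radial_extension f q = T q.
Proof.
move=> hW hf v1 x1 xv Kv.
have hf1 w : `|w| = 1 -> `|f w| = 1 by case: hf => h _ _; exact: h.
have hfi w w' : `|w| = 1 -> `|w'| = 1 -> `|f w - f w'| = `|w - w'|.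
  by case: hf => _ _; exact.
pose K (p : V) := \forall q \near p, radial_extension f q = T q.
pose g (s : R) := (1 - s) *: v + s *: x.
have gc : continuous g.
  move=> s; apply: cvgD; apply: cvgZl; last exact: cvg_id.
  by apply: cvgB; [exact: cvg_cst|exact: cvg_id].
(* The segment meets the origin only if [x] and [v] are antipodal. *)
have g0 s : 0 <= s <= 1 -> g s != 0.
  move=> /andP[s0 s1]; apply: contraNneq xv => /eqP.
  rewrite /g addrC addr_eq0 => /eqP sx.
  have := congr1 Num.norm sx.
  rewrite normrN !normrZ x1 v1 !mulr1 !ger0_norm ?subr_ge0// => s2.
  have s00 : s != 0 by apply/eqP => s0'; lra.
  by apply/eqP/(scalerI s00); rewrite sx -s2 scalerN.
have Kg s : K (g s) -> exists2 e : R, 0 < e & forall r, `|s - r| < e -> K (g r).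
  move=> /nbhs_interior.
  move=> /(gc s) /nbhs_normP[e /= e0 he]; exists e => // r; exact: he.
pose A := [set s : R | 0 <= s <= 1 /\ forall r, 0 <= r <= s -> K (g r)].
have gv : g 0 = v by rewrite /g subr0 scale1r scale0r addr0.
have A0 : A 0.
  split; first by rewrite lexx ler01.
  by move=> r /le_anti <-; rewrite gv.
have Aub : ubound A 1 by move=> s [/andP[]].
have Asup : has_sup A by split; [exists 0|exists 1].
set t := sup A.
have tA s : A s -> s <= t by apply: ub_le_sup; exists 1.
have t0 : 0 <= t by exact: tA.
have t1 : t <= 1 by apply: ge_sup => //; exists 0.
have Klt r : 0 <= r < t -> K (g r).
  move=> /andP[r0 rt].
  have tr : 0 < t - r by rewrite subr_gt0.
  have [s [_ hs]] := sup_adherent tr Asup; rewrite -/t subKr => /ltW rs.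
  by apply: hs; rewrite r0.
(* Agreement around [t] would push the supremum further, unless it is capped at 1. *)
have ext e : 0 < e -> (forall r, `|t - r| < e -> K (g r)) -> t = 1 /\ 0 < t.
  move=> e0 he.
  have := tA (Num.min 1 (t + e / 2)).
  have h : A (Num.min 1 (t + e / 2)).
    split; first by rewrite le_min ge_min lexx ler01/=; apply/andP; split; lra.
    move=> r /andP[r0]; rewrite le_min => /andP[_ rt].
    have [rlt|rge] := ltP r t; first by apply: Klt; rewrite r0.
    by apply: he; rewrite ltr_norml; apply/andP; split; lra.
  by move=> /(_ h); rewrite ge_min => /orP[|]; lra.
have tpos : 0 < t.
  rewrite lt_neqAle t0 andbT; apply/eqP => t0'.
  have [|e e0 he] := Kg 0; first by rewrite gv.
  by have [] := ext e e0; rewrite -?t0'//; lra.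
have sc := radial_extension_continuous hf1 hfi.
have Tc := linear_near_continuous hf1 Kv.
(* By continuity, a disagreement at [t] would persist at some parameter below [t]. *)
have ft : radial_extension f (g t) = T (g t).
  apply/eqP; rewrite -subr_eq0 -normr_eq0; apply/negPn/negP => ne.
  have : (fun s => `|radial_extension f (g s) - T (g s)|) @ t -->
      `|radial_extension f (g t) - T (g t)|.
    apply: cvg_norm; apply: cvgB.
      exact: (continuous_comp (gc t) (sc (g t))).
    exact: (continuous_comp (gc t) (Tc (g t))).
  move=> /cvgr_neq0 /(_ ne) /nbhs_normP[e /= e0 he].
  have r0 : 0 <= Num.max 0 (t - e / 2) < t.
    by rewrite le_max lexx gt_max tpos/=; lra.
  have := he (Num.max 0 (t - e / 2)).
  rewrite /= (nbhs_singleton (Klt _ r0)) subrr normr0 eqxx => H.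
  suff: false by []; apply: H; move: r0 => /andP[_ ?].
  rewrite gtr0_norm ?subr_gt0// ltrBlDr -ltrBlDl lt_max; apply/orP; right; lra.
set n := `|g t|.
have n0 : 0 < n by rewrite normr_gt0 g0// t0.
have ni0 : 0 < n^-1 by rewrite invr_gt0.
pose x0 := n^-1 *: g t.
have x01 : `|x0| = 1 by rewrite normalize_norm// g0// t0.
(* This is the parameter at which the segment crosses the ray through [x0 + v]; it is below [t]
   since [n > 0]. *)
pose r := t / (1 + n).
have r0t : 0 <= r < t.
  rewrite /r divr_ge0 ?addr_ge0 ?ltW//= ltr_pdivrMr ?addr_gt0//.
  by rewrite mulrDr mulr1 ltrDl mulr_gt0.
have x0v : x0 + v = (n^-1 + 1) *: g r.
  rewrite /x0 /g !scalerDr !scalerA addrAC -{2}[v]scale1r -scalerDl.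
  by congr (_ *: _ + _ *: _); rewrite /r; field; lra.
have Kt : K (g t).
  have -> : g t = n *: x0 by rewrite scalerA divff ?scale1r// gt_eqF.
  apply: radial_extension_linear_nearZ => //.
  apply: (linear_near_of_midpoint hW hf x01 v1) => //.
  - rewrite x0v scaler_eq0 negb_or g0 ?andbT; lra.
  - rewrite x0v; apply: radial_extension_linear_nearZ; last exact: Klt.
    by rewrite addr_gt0.
  - rewrite -(radial_extension_sphere f x01) radial_extensionZ// ft.
    by rewrite (linearZ_LR T).
have [e e0 he] := Kg _ Kt.
have [t1' _] := ext _ e0 he.
by move: Kt; rewrite t1' /g subrr scale0r scale1r add0r.
Qed.

(** * From the open subset to the whole sphere *)

Lemma relatively_open_linear_near (R : realType) (V W : normedModType R)
    (f : V -> W) (T : {linear V -> W}) (U : set V) (u : V) :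
  relatively_open (unit_sphere V) U -> (forall x, U x -> f x = T x) -> U u ->
  \forall q \near u, radial_extension f q = T q.
Proof.
move=> [US /open_subspaceP[Q oQ QU]] fT Uu.
have u1 : `|u| = 1 by exact: US.
have u0 : u != 0 by rewrite -normr_eq0 u1 oner_neq0.
have Qu : nbhs u Q.
  by apply: open_nbhs_nbhs; split => //; have [] : (Q `&` unit_sphere V) u
    by rewrite QU; split; [|exact: US].
(* Normalization is continuous at [u], so the cone over [U] is a neighbourhood of [u]. *)
have := normalize_continuous u0; rewrite u1 invr1 scale1r => /(_ _ Qu) H.
near=> q.
have q0 : q != 0 by near: q; exact: (@cvgr_neq0 _ _ _ _ _ id u).
have Uq : U (`|q|^-1 *: q).
  have [] : (U `&` unit_sphere V) (`|q|^-1 *: q); last by [].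
  rewrite -QU; split; last exact: normalize_norm.
  by near: q; exact: H.
by rewrite /radial_extension fT// (linearZ_LR T) scalerA divff ?scale1r// normr_eq0.
Unshelve. all: by end_near. Qed.

Theorem theorem3p12 (R : realType) (X Y : normedVectType R)
  (hX : strictly_convex X) (hY : strictly_convex Y)
  (tau : X -> Y)
  (htau : onto_isometry (unit_sphere X) (unit_sphere Y) tau)
  (hU : exists U : set X,
      [/\ U !=set0,
          relatively_open (unit_sphere X) U &
          linear_on U tau]) :
  linear_on (unit_sphere X) tau.
Proof.
have [U [[u Uu] Uo [T tauT]]] := hU.
have u1 : `|u| = 1 by case: Uo => US _; exact: US.
exists T => x x1.
(* The segment from [u] to [- u] passes through 0, so the antipode is handled by oddness of
   [tau]. *)
have [->|xu] := eqVneq x (- u).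
  case: htau => h _ hi.
  by rewrite (sphere_isometryN hY h hi u1) tauT// linearN.
have Kx := linear_near_sphere hY htau u1 x1 xu
  (relatively_open_linear_near Uo tauT Uu).
by rewrite -(nbhs_singleton Kx) radial_extension_sphere.
Qed.
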